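(* Let $n\equiv 3\pmod 4$ with $n>3$. Let $1\le r\le m$, let $M_r\in\mathfrak{C}_r$, and suppose $\det\tilde M_r>0$. Let $E_m^*\in\mathfrak{E}_m$ satisfy $\det E_m^*=\max\{\det E: E\in\mathfrak{E}_m\}$, and write $$E_m^*=\begin{bmatrix}M_r & B\\ B^T & A\end{bmatrix}$$ with $A=(a_{ij})$ of order $m-r$ and $B$ of size $r\times(m-r)$. If $a_{ij}=3$ for some $i\neq j$, then columns $i$ and $j$ of $B$ are equal, and columns $i$ and $j$ of $A$ are equal except for their $i$-th and $j$-th entries.
   Context: Fix an integer $n\equiv 3\pmod 4$, $n>3$. For $m\ge1$, $\mathfrak{C}_m$ is the set of symmetric positive definite $m\times m$ integer matrices $C=(c_{ij})$ with $c_{ii}=n$ and $c_{ij}\equiv n\pmod 4$ for all $i,j$. Given a fixed $M_r\in\mathfrak{C}_r$, for $m\ge r$, $\mathfrak{E}_m$ is the set of $E_m\in\mathfrak{C}_m$ whose leading $r\times r$ submatrix is $M_r$. For a square matrix $C$ of order $m$, $\tilde C$ denotes the matrix obtained from $C$ by replacing its $(m,m)$ entry by $3$. *)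

(* Defs.v *)
From HB Require Import structures.
From mathcomp Require Import all_boot all_order all_algebra.
Set Implicit Arguments. Unset Strict Implicit. Unset Printing Implicit Defensive.
Import Order.TTheory GRing.Theory Num.Theory.
Local Open Scope ring_scope.

Definition posdef (m : nat) (C : 'M[int]_m) : Prop :=
  forall x : 'rV[rat]_m, x != 0 ->
    0 < (x *m map_mx (fun z : int => z%:~R : rat) C *m x^T) 0 0.

Definition in_frakC (n : int) (m : nat) (C : 'M[int]_m) : Prop :=
  [/\ C^T = C,
      posdef C,
      forall i : 'I_m, C i i = n
    & forall i j : 'I_m, (C i j == n %[mod 4])%Z].

Definition in_frakE (n : int) (r k : nat) (Mr : 'M[int]_r) (E : 'M[int]_(r + k)) : Prop :=
  in_frakC n E /\ ulsubmx E = Mr.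

Definition tilde (m : nat) (C : 'M[int]_m) : 'M[int]_m :=
  \matrix_(i, j) if ((i : nat) == m.-1) && ((j : nat) == m.-1) then 3 else C i j.
Arguments posdef {m} C.
Arguments in_frakC n {m} C.
Arguments in_frakE n {r k} Mr E.
Arguments tilde {m} C.

(* Main.v *)
Require Import Defs.
From HB Require Import structures.
From mathcomp Require Import all_boot all_order all_algebra all_fingroup ring lra zify.
Import Order.TTheory GRing.Theory Num.Theory.
Local Open Scope ring_scope.

Set Implicit Arguments.
Unset Strict Implicit.
Unset Printing Implicit Defensive.

(**
Let [C] range over all matrices of [frakC n] containing [Mr] as a principal
submatrix, and let [tilde_at p C] be [C] with its [(p, p)] entry lowered to 3.
Then [det C = det (tilde_at p C) + (n - 3) det C_p], where [C_p] is [C] without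
row and column [p].
If [tilde_at p C] is positive definite, then bordering [C] with a second copy
of row [p] gives a matrix [G] of order one more with [det G > (n - 3) det C]
and with [tilde_at] of the new index again positive definite.  By induction
on the order, starting from [det (tilde Mr) > 0], every [C] is dominated by some
[C'] of the same order with a positive definite [tilde_at p C'], and a [C] of
maximal determinant has positive definite [tilde_at p C] for every [p] outside
[Mr]: otherwise [det C <= (n - 3) det C_p <= (n - 3) det C' < det G] for some
dominating [C'] of [C_p].

Now let [E] be maximal, with off-diagonal entry 3 at [(p, q)], and let [u], [v]
be the rest of its rows [p] and [q], [R] the rest of [E].  With [a], [b], [c] the
values of [R^-1] at [(u, u)], [(v, v)], [(u, v)], the above gives [a, b < 3].
Overwriting [q] by a copy of [p], or [p] by a copy of [q], does not increase the
determinant; in terms of the Schur complement of [R] this contradicts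
[a + b - 2 c > 0], so [u = v].
*)

(** * Positive definiteness, congruence and Schur complements *)

Definition pd {F : numDomainType} {m : nat} (A : 'M[F]_m) : Prop :=
  forall x : 'rV_m, x != 0 -> 0 < (x *m A *m x^T) 0 0.

(** Equal orders make [f] a permutation; it acts on rows and columns alike, so its sign occurs
    squared. *)
Lemma det_mxsub_inj {R : comPzRingType} {m n : nat} (f : 'I_m -> 'I_n)
    (A : 'M[R]_n) :
  injective f -> m = n -> \det (mxsub f f A) = \det A.
Proof.
move=> f_inj eq_mn; move: f f_inj; rewrite eq_mn => f f_inj.
have -> : mxsub f f A = row_perm (perm f_inj) (col_perm (perm f_inj) A).
  by apply/matrixP => i j; rewrite !mxE !permE.
rewrite row_permE col_permE !det_mulmx !det_perm.
rewrite odd_permV [\det A * _]mulrC mulrA -signr_addb.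
by rewrite addbb mul1r.
Qed.

Section PositiveDefinite.

Variable F : realFieldType.

Lemma pd_mul m n (A : 'M[F]_n) (P : 'M_(m, n)) :
  (forall x : 'rV_m, x != 0 -> x *m P != 0) -> pd A -> pd (P *m A *m P^T).
Proof.
by move=> Pinj Apd x /Pinj /Apd; rewrite trmx_mul !mulmxA.
Qed.

(** [f] may repeat indices: this is what handles duplicated rows later. *)
Lemma mxsub_congruence m n (f : 'I_m -> 'I_n) (A : 'M[F]_n) :
  mxsub f f A = rowsub f 1%:M *m A *m (rowsub f 1%:M)^T.
Proof.
by rewrite trmx_mxsub trmx1 mulmx_colsub mulmx1 -rowsubE -mxsub_comp.
Qed.

Lemma pd_mxsub m n (f : 'I_m -> 'I_n) (A : 'M[F]_n) :
  injective f -> pd A -> pd (mxsub f f A).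
Proof.
move=> f_inj Apd; rewrite mxsub_congruence.
apply: pd_mul Apd => x; apply: contraNneq => xP0.
apply/eqP/rowP => i; have := congr1 (fun v : 'rV_n => v 0 (f i)) xP0.
rewrite !mxE (bigD1 i) //= !mxE eqxx mulr1 big1 ?addr0 // => j jDi.
by rewrite !mxE (inj_eq f_inj) (negPf jDi) mulr0.
Qed.

Lemma pd_unitmx m (A : 'M[F]_m) : pd A -> A \in unitmx.
Proof.
move=> Apd; rewrite -row_free_unit -kermx_eq0; apply: contraT => /rowV0Pn[v].
by move=> /sub_kermxP vA0 /Apd; rewrite vA0 mul0mx mxE ltxx.
Qed.

Section Schur.

Variables (m n : nat) (A : 'M[F]_m) (U : 'M[F]_(m, n)) (R : 'M[F]_n).
Hypotheses (Rsym : R^T = R) (Rpd : pd R).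

Let W := U *m invmx R.
Let L := block_mx 1%:M W 0 1%:M.

Lemma schur_factor :
  block_mx A U U^T R =
  L *m block_mx (A - U *m invmx R *m U^T) 0 0 R *m L^T.
Proof.
have Ru := pd_unitmx Rpd.
rewrite /L tr_block_mx !mulmx_block !trmx1 !trmx0 !mul1mx !mul0mx !mulmx0.
rewrite !add0r !addr0 !mulmx1 {1 2 3}/W mulmxKV // trmx_mul trmx_inv Rsym.
by rewrite mulKVmx // mulmxA subrK add0r.
Qed.

Lemma det_schur :
  \det (block_mx A U U^T R) = \det (A - U *m invmx R *m U^T) * \det R.
Proof.
by rewrite schur_factor !det_mulmx det_tr /L !det_ublock !det1 !mul1r mulr1.
Qed.

Let Lunit : L \in unitmx.
Proof. by rewrite unitmxE det_ublock !det1 mulr1 unitr1. Qed.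

(** Congruence by the unitriangular [L] reduces the block matrix to the diagonal sum of its Schur
    complement and [R]. *)
Lemma pd_schurP :
  pd (block_mx A U U^T R) <-> pd (A - U *m invmx R *m U^T).
Proof.
set S : 'M_m := A - _; split => [Bpd|Spd].
  have -> : S = mxsub (lshift n) (lshift n)
      (invmx L *m block_mx A U U^T R *m (invmx L)^T).
    rewrite schur_factor -/S trmx_inv !mulmxA mulVmx // mul1mx mulmxK ?unitmx_tr //.
    by rewrite -ulsubmxEsub block_mxKul.
  apply: pd_mxsub; first exact: lshift_inj.
  apply: pd_mul Bpd => x; apply: contraNneq => xL0.
  by rewrite -[x](mulmxKV Lunit) xL0 mul0mx.
rewrite schur_factor -/S; apply: pd_mul => [x|x].
  by apply: contraNneq => xL0; rewrite -[x](mulmxK Lunit) xL0 mul0mx.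
rewrite -[x]hsubmxK; move: (lsubmx x) (rsubmx x) => y z yz0.
rewrite mul_row_block !mulmx0 addr0 add0r tr_row_mx mul_row_col mxE.
have [y0|y0] := eqVneq y 0.
  rewrite y0 !mul0mx [X in X + _]mxE add0r; apply: Rpd.
  by apply: contraNneq yz0 => z0; rewrite y0 z0 row_mx0.
have [->|z0] := eqVneq z 0; first by rewrite !mul0mx [X in _ + X]mxE addr0; apply: Spd.
by apply: addr_gt0; [apply: Spd | apply: Rpd].
Qed.

End Schur.

Lemma pd_scalar11 (A : 'M[F]_1) : pd A <-> 0 < \det A.
Proof.
rewrite det_mx11; split => [/(_ 1%:M)|A0 x x0].
  by rewrite trmx1 mulmx1 mul1mx oner_eq0; apply.
have -> : (x *m A *m x^T) 0 0 = A 0 0 * x 0 0 ^+ 2.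
  by rewrite !mxE big_ord1 !mxE big_ord1; ring.
rewrite mulr_gt0 // exprn_even_gt0 //=; apply: contraNneq x0 => x00.
by apply/eqP/rowP => i; rewrite (ord1 i) x00 mxE.
Qed.

Lemma pd_drsub m n (A : 'M[F]_(m + n)) : pd A -> pd (drsubmx A).
Proof. by move=> Apd; rewrite drsubmxEsub; apply: pd_mxsub => //; exact: rshift_inj. Qed.

Lemma sym_block m n (A : 'M[F]_(m + n)) : A^T = A ->
  A = block_mx (ulsubmx A) (ursubmx A) (ursubmx A)^T (drsubmx A) /\
  (drsubmx A)^T = drsubmx A.
Proof.
by move=> Asym; rewrite trmx_ursub trmx_drsub Asym; split=> //; rewrite submxK.
Qed.

Lemma pd_det_gt0 m (A : 'M[F]_m) : A^T = A -> pd A -> 0 < \det A.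
Proof.
elim: m A => [|m IH] A; first by rewrite det_mx00.
suff: forall B : 'M[F]_(1 + m), B^T = B -> pd B -> 0 < \det B by apply.
move=> {}A Asym Apd; have [eA Rsym] := sym_block Asym; have Rpd := pd_drsub Apd.
move: Apd; rewrite eA det_schur // pd_schurP // pd_scalar11 => S0.
by rewrite mulr_gt0 // IH.
Qed.

(** Once [p] is moved to the front, the Schur complement of the rest is a scalar with the sign of
    [\det A], since the rest has positive determinant. *)
Lemma pd_of_row' m (A : 'M[F]_m.+1) (p : 'I_m.+1) :
  A^T = A -> pd (row' p (col' p A)) -> 0 < \det A -> pd A.
Proof.
move=> Asym Rpd A0.
pose f : 'I_(1 + m) -> 'I_m.+1 := lift_perm ord0 p 1%g.
have f_inj : injective f by exact: perm_inj.
have fS i : f (lift ord0 i) = lift p i by rewrite /f lift_perm_lift perm1.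
pose B : 'M_(1 + m) := mxsub f f A.
have Bsym : B^T = B by apply/matrixP => i j; rewrite !mxE -[in RHS]Asym mxE.
have eR : drsubmx B = row' p (col' p A).
  by apply/matrixP => i j; rewrite !mxE !rshift1 !fS.

have [eB Rsym] := sym_block Bsym.
have {}Rpd : pd (drsubmx B) by rewrite eR.
have Bpd : pd B.
  move: A0; rewrite -(det_mxsub_inj _ f_inj) // -/B eB det_schur //.
  by rewrite (pmulr_lgt0 _ (pd_det_gt0 Rsym Rpd)) pd_schurP // pd_scalar11.
have -> : A = mxsub (lift_perm ord0 p 1)^-1%g (lift_perm ord0 p 1)^-1%g B.
  by apply/matrixP => i j; rewrite !mxE /f !permKV.
by apply: pd_mxsub Bpd; exact: perm_inj.
Qed.

End PositiveDefinite.

(** * Raising one diagonal entry *)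

Section PositiveDefiniteDelta.

Variable F : realFieldType.

Lemma form_delta m (x : 'rV[F]_m) (q : 'I_m) (d : F) :
  (x *m (d *: delta_mx q q) *m x^T) 0 0 = d * x 0 q ^+ 2.
Proof.
rewrite -scalemxAr -scalemxAl mxE -(mul_delta_mx (0 : 'I_1)) mulmxA -colE.
by rewrite -mulmxA -rowE mxE big_ord1 !mxE -expr2.
Qed.

Lemma pd_add_delta m (A : 'M[F]_m) (q : 'I_m) (d : F) :
  0 <= d -> pd A -> pd (A + d *: delta_mx q q).
Proof.
move=> d0 Apd x /Apd; rewrite mulmxDr mulmxDl [X in _ -> 0 < X]mxE form_delta.
by move=> A0; rewrite ltr_pwDl // mulr_ge0 ?sqr_ge0.
Qed.

(** The congruence part vanishes only if the pushforward of [x] along [h] is zero. Injectivity away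
    from [q] then forces a nonzero [x] to be nonzero at [q], where the added term is positive. *)
Lemma pd_mxsub_add_delta m n (h : 'I_m -> 'I_n) (A : 'M[F]_n) (q : 'I_m) (d : F) :
  0 < d -> {in predC1 q &, injective h} -> pd A ->
  pd (mxsub h h A + d *: delta_mx q q).
Proof.
move=> d0 h_inj Apd x x0; rewrite mulmxDr mulmxDl [X in 0 < X]mxE form_delta.
have -> : x *m mxsub h h A *m x^T =
    (x *m rowsub h 1%:M) *m A *m (x *m rowsub h 1%:M)^T.
  by rewrite mxsub_congruence trmx_mul !mulmxA.
set y := x *m _; have [y0|/Apd y0] := eqVneq y 0; last first.
  by rewrite ltr_pwDl // mulr_ge0 ?sqr_ge0 // ltW.
rewrite y0 !mul0mx [X in X + _]mxE add0r mulr_gt0 // exprn_even_gt0 //=.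
apply: contraNneq x0 => xq; apply/eqP/rowP => i.
have [->|iDq] := eqVneq i q; first by rewrite xq mxE.
have := congr1 (fun v : 'rV_n => v 0 (h i)) y0.
rewrite !mxE (bigD1 i) //= !mxE eqxx mulr1 big1 ?addr0 // => j jDi.
have [->|jDq] := eqVneq j q; first by rewrite xq mul0r.
rewrite !mxE; have [/h_inj hij|] := eqVneq (h j) (h i); last by rewrite mulr0.
by rewrite hij ?eqxx ?inE // in jDi.
Qed.

End PositiveDefiniteDelta.

(** * Lowering a diagonal entry to 3 and duplicating a row, over the integers *)

Definition tilde_at {m : nat} (p : 'I_m) (C : 'M[int]_m) : 'M[int]_m :=
  \matrix_(i, j) if (i == p) && (j == p) then 3 else C i j.

(* Row [i] of [pullback n h C] copies row [h i] of [C]: along an [h] that is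
   injective except for [h q = h q'], it duplicates row [h q], the two copies
   meeting in off-diagonal entries 3. *)
Definition pullback (n : int) {m' m : nat} (h : 'I_m' -> 'I_m) (C : 'M[int]_m) :
    'M[int]_m' :=
  \matrix_(i, j) if i == j then n else if h i == h j then 3 else C (h i) (h j).

Local Notation toQ := (map_mx (intr : int -> rat)).

(** The cofactors along row [p] do not see that row, so the two expansions differ only in the term
    at [(p, p)]. *)
Lemma det_tilde_at m (C : 'M[int]_m.+1) (p : 'I_m.+1) :
  \det C = \det (tilde_at p C) + (C p p - 3) * \det (row' p (col' p C)).
Proof.
rewrite !(expand_det_row _ p) (bigD1 p) //= [in RHS](bigD1 p) //= mxE !eqxx /=.
have cofE j : cofactor (tilde_at p C) p j = cofactor C p j.
  rewrite /cofactor; congr (_ * \det _); apply/matrixP => a b.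
  by rewrite !mxE eq_sym (negPf (neq_lift _ _)).
rewrite cofE addrAC; congr (_ + _).
  by rewrite /cofactor addnn -signr_odd odd_double expr0 mul1r; ring.
by apply: eq_bigr => j jDp; rewrite cofE mxE (negPf jDp) andbF.
Qed.

Lemma tr_tilde_at m (C : 'M[int]_m) (p : 'I_m) :
  C^T = C -> (tilde_at p C)^T = tilde_at p C.
Proof. by move=> Csym; apply/matrixP => i j; rewrite !mxE andbC -{1}Csym mxE. Qed.

Lemma toQ_sym m (C : 'M[int]_m) : C^T = C -> (toQ C)^T = toQ C.
Proof. by move=> Csym; rewrite map_trmx Csym. Qed.

Lemma posdef_det_gt0 m (C : 'M[int]_m) : C^T = C -> posdef C -> 0 < \det C.
Proof.
(* [posdef C] is convertible to [pd (toQ C)]. *)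
move=> Csym Cpd; have := pd_det_gt0 (toQ_sym Csym) Cpd.
by rewrite det_map_mx ltr0z.
Qed.

Lemma posdef_mxsub m n (f : 'I_m -> 'I_n) (C : 'M[int]_n) :
  injective f -> posdef C -> posdef (mxsub f f C).
Proof. by move=> f_inj Cpd; rewrite /posdef map_mxsub; exact: pd_mxsub. Qed.

(** The principal submatrix without [p] is that of [C], hence positive definite, so the sign of the
    determinant decides. *)
Lemma posdef_tilde_at m (C : 'M[int]_m) (p : 'I_m) :
  C^T = C -> posdef C -> 0 < \det (tilde_at p C) -> posdef (tilde_at p C).
Proof.
case: m C p => [|m] C p; first by case: p.
move=> Csym Cpd C0.
apply: (@pd_of_row' _ _ _ p).
- exact/toQ_sym/tr_tilde_at.
- suff -> : row' p (col' p (toQ (tilde_at p C))) = toQ (mxsub (lift p) (lift p) C).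
    by apply: posdef_mxsub Cpd; exact: lift_inj.
  by apply/matrixP => a b; rewrite !mxE eq_sym (negPf (neq_lift _ _)).
- by rewrite det_map_mx ltr0z.
Qed.

(** * Positive definiteness after duplicating a row *)

Section Pullback.

Variables (n : int) (m' m : nat) (h : 'I_m' -> 'I_m) (C : 'M[int]_m).
Variables (q q' : 'I_m').
Hypotheses (n_gt3 : 3 < n) (qDq' : q != q') (hqq' : h q = h q').
Hypothesis h_inj : {in predC1 q &, injective h}.
Hypothesis Cdiag : forall i, C i i = n.
Hypothesis Tpd : posdef (tilde_at (h q) C).

Let h_eq i j : i != j -> h i = h j -> (i == q) && (j == q') || (i == q') && (j == q).
Proof.
have aux a : a != q -> h a = h q -> a = q'.
  by move=> aDq haq; apply: h_inj; rewrite ?inE // 1?eq_sym // -hqq'.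
have [->|iDq] := eqVneq i q.
  rewrite [q == j]eq_sym => jDq hij; rewrite (aux j) ?eqxx //.
have [->|jDq] := eqVneq j q => iDj hij; first by rewrite (aux i) ?eqxx ?andbT ?orbT.
by move: iDj; rewrite (h_inj iDq jDq hij) eqxx.
Qed.

Let d_gt0 : 0 < (n - 3)%:~R :> rat.
Proof. by rewrite ltr0z subr_gt0. Qed.

(* The matrix is the congruence [mxsub h h (tilde_at (h q) C)], which is positive
   semidefinite with kernel [e_q - e_q'], plus [n - 3] at [(q, q)]. *)
Lemma posdef_tilde_pullback : posdef (tilde_at q' (pullback n h C)).
Proof.
suff eT : toQ (tilde_at q' (pullback n h C)) =
    mxsub h h (toQ (tilde_at (h q) C)) + (n - 3)%:~R *: delta_mx q q.
  rewrite /posdef eT; exact: pd_mxsub_add_delta.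
(* Reduces the entrywise rational identity to an integer one, settled by cases on the indices. *)
have toE (a b : int) (c : bool) :
    a = b + (n - 3) * c%:R -> a%:~R = b%:~R + (n - 3)%:~R * c%:R :> rat.
  by move=> ->; rewrite rmorphD rmorphM /= rmorph_nat.
apply/matrixP => i j; rewrite !mxE; apply: toE.
have [<-|iDj] := eqVneq i j; last first.
  have -> : (i == q') && (j == q') = false.
    by apply: contraNF iDj => /andP[/eqP-> /eqP->].
  have -> : (i == q) && (j == q) = false.
    by apply: contraNF iDj => /andP[/eqP-> /eqP->].
  rewrite mulr0 addr0; have [hij|hij] := eqVneq (h i) (h j).
    case/orP: (h_eq iDj hij) => /andP[/eqP-> /eqP->]; by rewrite -?hqq' eqxx.
  case: ifP => // /andP[/eqP hi /eqP hj]; by rewrite hi hj eqxx in hij.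
rewrite !andbb; have [->|iDq'] := eqVneq i q'.
  by rewrite hqq' eqxx eq_sym (negPf qDq') mulr0 addr0.
have [->|iDq] := eqVneq i q; first by rewrite eqxx mulr1 subrKC.
have [hi|hi] := eqVneq (h i) (h q); last by rewrite mulr0 addr0 Cdiag.
by case/orP: (h_eq iDq hi) => /andP[ei ej]; rewrite ?(negPf iDq) ?(negPf iDq') in ei.
Qed.

Lemma posdef_pullback : posdef (pullback n h C).
Proof.
suff eG : toQ (pullback n h C) =
    toQ (tilde_at q' (pullback n h C)) + (n - 3)%:~R *: delta_mx q' q'.
  rewrite /posdef eG; apply: pd_add_delta (ltW d_gt0) posdef_tilde_pullback.
apply/matrixP => i j; rewrite !mxE.
case: ifP => [/eqP<-|]; last first.
  by case: andP => [[/eqP-> /eqP->]|]; rewrite ?eqxx // mulr0 addr0.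
by rewrite andbb; case: eqP => _; rewrite ?mulr1 ?mulr0 ?addr0 // -intrD subrKC.
Qed.

Lemma in_frakC_pullback :
  (n == 3 %[mod 4])%Z -> in_frakC n C -> in_frakC n (pullback n h C).
Proof.
move=> n3 [Csym _ _ Cmod]; split.
- apply/matrixP => i j; rewrite !mxE eq_sym; case: ifP => // _.
  by rewrite eq_sym -{1}Csym mxE.
- exact: posdef_pullback.
- by move=> i; rewrite mxE eqxx.
- move=> i j; rewrite mxE; case: ifP => // _; case: ifP => // _.
  by rewrite eq_sym.
Qed.

End Pullback.

(** Brings chosen indices to the front, so that block decompositions apply to them. *)
Lemma extend_injection a b N (h : 'I_a -> 'I_N) :
  injective h -> (a + b)%N = N ->
  exists2 f : 'I_(a + b) -> 'I_N, injective f & forall x, f (lshift b x) = h x.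
Proof.
move=> h_inj abN.
have card_b : b = #|[predC codom h]|.
  apply: (@addnI a); rewrite abN; have := cardC [in codom h].
  by rewrite card_codom // !card_ord.
pose g y := enum_val (cast_ord card_b y).
have gP y x : g y = h x -> False.
  by move=> e; have := enum_valP (cast_ord card_b y); rewrite -/(g y) e inE codom_f.
pose f x := match split x with inl y => h y | inr y => g y end.
exists f => [x y|x]; last by rewrite /f -[lshift b x]/(unsplit (inl x)) unsplitK.
rewrite /f -{2}[x]splitK -{2}[y]splitK.
case: (split x) (split y) => [u|u] [v|v] e.
- by rewrite (h_inj _ _ e).
- by case: (@gP v u).
- by case: (@gP u v).
- by rewrite (cast_ord_inj (enum_val_inj e)).
Qed.

(** * Growth of determinants under bordering, and maximal matrices *)

Section Maximal.

Variables (n : int) (r : nat) (Mr : 'M[int]_r).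
Hypotheses (n3 : (n == 3 %[mod 4])%Z) (n_gt3 : 3 < n) (r_gt0 : (0 < r)%N).
Hypothesis Mr_tilde : 0 < \det (tilde Mr).

Lemma bordered_extension N (C : 'M[int]_N) (g : 'I_r -> 'I_N) (p : 'I_N) :
  injective g -> in_frakC n C -> mxsub g g C = Mr -> posdef (tilde_at p C) ->
  exists (G : 'M[int]_N.+1) (g' : 'I_r -> 'I_N.+1),
    [/\ injective g', in_frakC n G, mxsub g' g' G = Mr,
        posdef (tilde_at ord0 G) & (n - 3) * \det C < \det G].
Proof.
move=> g_inj CC CMr Tpd; have [Csym Cpd Cdiag Cmod] := CC.
(* Index 0 is the new one and copies [p]; every other index returns to its old position. *)
pose h (i : 'I_N.+1) := odflt p (unlift ord0 i).
have h0 : h ord0 = p by rewrite /h unlift_none.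
have hS i : h (lift ord0 i) = i by rewrite /h liftK.
pose q := lift ord0 p; have hq : h q = p by exact: hS.
have qD0 : q != ord0 by rewrite eq_sym neq_lift.
have hqq' : h q = h ord0 by rewrite hq h0.
have h_inj : {in predC1 q &, injective h}.
  move=> i j; rewrite !inE => iDq jDq.
  case: (unliftP ord0 i) iDq => [i'|] -> iDq; case: (unliftP ord0 j) jDq => [j'|] -> jDq;
    rewrite ?h0 ?hS // => e; first by rewrite e.
  - by rewrite e eqxx in iDq.
  - by rewrite -e eqxx in jDq.
have Tpd' : posdef (tilde_at (h q) C) by rewrite hq.
pose G := pullback n h C.
have GC : in_frakC n G := in_frakC_pullback n_gt3 qD0 hqq' h_inj Cdiag Tpd' n3 CC.
have Gtpd : posdef (tilde_at ord0 G) :=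
  posdef_tilde_pullback n_gt3 qD0 hqq' h_inj Cdiag Tpd'.
have subG : mxsub (lift ord0) (lift ord0) G = C.
  apply/matrixP => i j; rewrite !mxE !hS (inj_eq lift_inj).
  by case: eqVneq => // ->; rewrite Cdiag.
exists G, (lift ord0 \o g); split=> //.
- by apply: inj_comp => //; exact: lift_inj.
- by rewrite mxsub_comp subG.
have [Gsym _ Gdiag _] := GC.
rewrite (det_tilde_at G ord0) Gdiag.
have -> : row' ord0 (col' ord0 G) = C.
  by rewrite -[RHS]subG; apply/matrixP => i j; rewrite !mxE.
(* The excess over [(n - 3) * \det C] is [\det (tilde_at ord0 G)]. *)
by rewrite ltrDr posdef_det_gt0 // tr_tilde_at.
Qed.

(** An arbitrary injection locates [Mr], since bordering and deletion shift positions; [p] may lie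
    inside the copy of [Mr]. *)
Let dominated N := forall (C : 'M[int]_N) (g : 'I_r -> 'I_N),
  injective g -> in_frakC n C -> mxsub g g C = Mr ->
  exists (C' : 'M[int]_N) (g' : 'I_r -> 'I_N) (p : 'I_N),
    [/\ injective g', in_frakC n C', mxsub g' g' C' = Mr,
        posdef (tilde_at p C') & \det C <= \det C'].

Lemma improve_tilde_le0 N (C : 'M[int]_N.+1) (g : 'I_r -> 'I_N.+1) (p : 'I_N.+1) :
  dominated N -> injective g -> in_frakC n C -> mxsub g g C = Mr ->
  p \notin codom g -> \det (tilde_at p C) <= 0 ->
  exists (G : 'M[int]_N.+1) (g' : 'I_r -> 'I_N.+1),
    [/\ injective g', in_frakC n G, mxsub g' g' G = Mr,
        posdef (tilde_at ord0 G) & \det C < \det G].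
Proof.
move=> domN g_inj [Csym Cpd Cdiag Cmod] CMr pg C0.
pose R : 'M_N := row' p (col' p C).
have eR : R = mxsub (lift p) (lift p) C by apply/matrixP => i j; rewrite !mxE.
have RC : in_frakC n R.
  split.
  - by rewrite eR; apply/matrixP => i j; rewrite !mxE -{1}Csym mxE.
  - by rewrite eR; apply: posdef_mxsub Cpd; exact: lift_inj.
  - by move=> i; rewrite !mxE.
  - by move=> i j; rewrite !mxE.
have pDg x : p != g x by apply: contraNneq pg => ->; exact: codom_f.
have [g1 g1E] : {g1 : 'I_r -> 'I_N | forall x, g x = lift p (g1 x)}.
  by exists (fun x => sval (unlift_some (pDg x))) => x; case: (unlift_some _).
have g1_inj : injective g1 by move=> x y e; apply: g_inj; rewrite !g1E e.
have RMr : mxsub g1 g1 R = Mr.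
  by rewrite eR -CMr; apply/matrixP => i j; rewrite !mxE !g1E.
have [C' [g' [p' [g'_inj C'C C'Mr C'pd leRC']]]] := domN R g1 g1_inj RC RMr.
have [G [g2 [g2_inj GC GMr Gpd ltG]]] := bordered_extension g'_inj C'C C'Mr C'pd.
exists G, g2; split => //.
apply: le_lt_trans ltG; rewrite (det_tilde_at C p) Cdiag -/R.
by rewrite ler_wnDl // ler_wpM2l // subr_ge0 ltW.
Qed.

Lemma dominating_tilde_posdef N : dominated N.
Proof.
elim: N => [|N IH] C g g_inj CC CMr; first by case: (g (Ordinal r_gt0)).
have [Csym Cpd Cdiag Cmod] := CC.
have [/forallP g_onto|/forallPn[p pg]] := boolP [forall p, p \in codom g]; last first.
  have [C0|] := ltP 0 (\det (tilde_at p C)).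
    by exists C, g, p; split => //; exact: posdef_tilde_at.
  case/(improve_tilde_le0 IH g_inj CC CMr pg) => G [g' [g'_inj GC GMr Gpd /ltW ltG]].
  by exists G, g', ord0.
(* Here [C] is a reordering of [Mr], and the hypothesis on [tilde Mr] applies at the image of its
   last index. *)
have rN : r = N.+1.
  by rewrite -(card_ord N.+1) -(eq_card g_onto) card_codom // card_ord.
have lt_last : (r.-1 < r)%N by rewrite prednK.
exists C, g, (g (Ordinal lt_last)); split => //.
apply: posdef_tilde_at => //; rewrite -(det_mxsub_inj _ g_inj rN).
suff -> : mxsub g g (tilde_at (g (Ordinal lt_last)) C) = tilde Mr by [].
by rewrite -CMr; apply/matrixP => i j; rewrite !mxE !(inj_eq g_inj) -!val_eqE.
Qed.

Lemma maximal_tilde_posdef N (E : 'M[int]_N) (g : 'I_r -> 'I_N) (p : 'I_N) :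
  injective g -> in_frakC n E -> mxsub g g E = Mr -> p \notin codom g ->
  (forall (G : 'M[int]_N) (g' : 'I_r -> 'I_N), injective g' -> in_frakC n G ->
     mxsub g' g' G = Mr -> \det G <= \det E) ->
  posdef (tilde_at p E).
Proof.
case: N E g p => [|N] E g p; first by case: p.
move=> g_inj EC EMr pg Emax; have [Esym Epd _ _] := EC.
apply: posdef_tilde_at => //; rewrite ltNge; apply/negP => E0.
have [G [g' [g'_inj GC GMr _]]] :=
  improve_tilde_le0 (@dominating_tilde_posdef N) g_inj EC EMr pg E0.
by rewrite ltNge (Emax G g').
Qed.

End Maximal.

(** * Two-row Schur complements *)

Section TwoRows.

Variable F : realFieldType.

Lemma det_mx22 (S : 'M[F]_2) : \det S = S 0 0 * S 1 1 - S 0 1 * S 1 0.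
Proof.
rewrite (expand_det_row _ 0) !big_ord_recl big_ord0 addr0 /cofactor !det_mx11 !mxE /=.
rewrite expr0 mul1r expr1 mulN1r mulrN.
by congr (S _ _ * S _ _ - S _ _ * S _ _); apply: val_inj.
Qed.

Lemma pd_diag m (S : 'M[F]_m) (i : 'I_m) : pd S -> 0 < S i i.
Proof.
have e0 : delta_mx 0 i != 0 :> 'rV[F]_m.
  by apply/eqP => /rowP/(_ i)/eqP; rewrite !mxE !eqxx oner_eq0.
by move=> /(_ _ e0); rewrite trmx_delta -rowE -colE !mxE.
Qed.

Lemma pd_invmx m (R : 'M[F]_m) : R^T = R -> pd R -> pd (invmx R).
Proof.
move=> Rsym Rpd; have Ru := pd_unitmx Rpd.
have -> : invmx R = invmx R *m R *m (invmx R)^T.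
  by rewrite mulVmx // mul1mx trmx_inv Rsym.
apply: pd_mul Rpd => x; apply: contraNneq => xR0.
by rewrite -[x](mulmxKV Ru) xR0 mul0mx.
Qed.

(** Dividing by [\det R] leaves 2 by 2 determinants. With a, b the diagonal entries of [beta] and c
    the other one, the mean of the bounds for the two [i] is (3 - c)^2 + (a - b)^2 / 4 <= (3 - (a +
    b) / 2)^2, whereas distinct rows give c < (a + b) / 2 < 3. *)
Lemma eq_rows_of_det_le m (n : F) (A beta : 'M[F]_2) (U : 'M[F]_(2, m)) (R : 'M[F]_m) :
  R^T = R -> pd R -> beta = U *m invmx R *m U^T ->
  3 < n -> (forall i, A i i = n) -> (forall i j, i != j -> A i j = 3) ->
  (forall i, 0 < 3 - beta i i) ->
  (forall i, \det (block_mx A (rowsub (fun=> i) U) (rowsub (fun=> i) U)^T R)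
               <= \det (block_mx A U U^T R)) ->
  row 0 U = row 1 U.
Proof.
move=> Rsym Rpd betaE n_gt3 Ad Ao b_lt3 le_det.
have beta_sym : beta 1 0 = beta 0 1.
  have e : beta^T = beta by rewrite betaE !trmx_mul trmxK trmx_inv Rsym mulmxA.
  by rewrite -{1}e mxE.
have le_schur i : (n - beta i i) ^+ 2 - (3 - beta i i) ^+ 2 <=
    (n - beta 0 0) * (n - beta 1 1) - (3 - beta 0 1) ^+ 2.
  have := le_det i; rewrite !det_schur // ler_pM2r ?pd_det_gt0 //.
  have -> : rowsub (fun=> i) U *m invmx R *m (rowsub (fun=> i) U)^T =
      mxsub (fun=> i) (fun=> i) beta :> 'M_2.
    by rewrite betaE trmx_mxsub mul_rowsub_mx -mxsub_mul.
  rewrite -betaE !det_mx22 !mxE !Ad !Ao // beta_sym.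
  by rewrite !expr2.
apply/eqP; rewrite -subr_eq0; apply: contraT => /(pd_invmx Rsym Rpd).
(* As [w *m U] with w = (1, -1), the difference has under [invmx R] the value of [beta] at w. *)
have -> : row 0 U - row 1 U = (delta_mx 0 0 - delta_mx 0 1) *m U.
  by rewrite mulmxBl -!rowE.
have -> : forall w : 'rV_2, (w *m U *m invmx R *m (w *m U)^T) = w *m beta *m w^T.
  by move=> w; rewrite trmx_mul betaE !mulmxA.
rewrite linearB /= !trmx_delta mulmxBl mulmxBr !mulmxBl -!rowE -!colE !mxE beta_sym.
(* With [s] the mean of the [3 - beta i i], the hypotheses would force
   [3 - beta 0 1 > s > 0] and [(beta 0 0 - beta 1 1) ^+ 2 < 0]. *)
move: (le_schur 0) (le_schur 1) (b_lt3 0) (b_lt3 1).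
move: (beta 0 0) (beta 1 1) (beta 0 1) => a b c le0 le1 a_lt3 b_lt3' c_lt.
have s_gt0 : 0 < 3 - (a + b) / 2 by lra.
have : (3 - (a + b) / 2) ^+ 2 < (3 - c) ^+ 2 by rewrite ltr_pXn2r ?nnegrE //; lra.
have := sqr_ge0 (a - b); nra.
Qed.

End TwoRows.

(** * From determinant bounds to equality of two rows *)

Lemma eq_entries_of_maximal (n : int) N (E : 'M[int]_N) (p q : 'I_N) :
  3 < n -> in_frakC n E -> p != q -> E p q = 3 ->
  posdef (tilde_at p E) -> posdef (tilde_at q E) ->
  \det (pullback n (fun x => if x == q then p else x) E) <= \det E ->
  \det (pullback n (fun x => if x == p then q else x) E) <= \det E ->
  forall z, z != p -> z != q -> E p z = E q z.
Proof.
move=> n_gt3 [Esym Epd Ediag _] pDq Epq Ppd Qpd leP leQ z zDp zDq.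
have Eqp : E q p = 3 by rewrite -Esym mxE.
have N_ge2 : (2 + (N - 2))%N = N.
  apply: subnKC; have := ltn_ord p; have := ltn_ord q; move: pDq.
  by rewrite -val_eqE /=; lia.
pose pq (i : 'I_2) := if i == 0 then p else q.
have pq_inj : injective pq.
  rewrite /pq => i j; case: eqVneq => [->|i0]; case: eqVneq => [->|j0] // e.
  - by rewrite e eqxx in pDq.
  - by rewrite e eqxx in pDq.
  - by move: i j i0 j0 {e} => [[|[|?]] ?] [[|[|?]] ?] // _ _; apply: val_inj.
(* [f] lists [p] and [q] first, so [U] below consists of the rest of their rows. *)
have [f f_inj fpq] := extend_injection pq_inj N_ge2.
have f_sep i y : f (rshift 2 y) != pq i.
  by rewrite -fpq (inj_eq f_inj) eq_rlshift.
pose M (G : 'M_N) := mxsub f f (toQ G).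
have M_block G : G^T = G -> M G =
    block_mx (ulsubmx (M G)) (ursubmx (M G)) (ursubmx (M G))^T (drsubmx (M G)) /\
    (drsubmx (M G))^T = drsubmx (M G).
  by move=> Gsym; apply: sym_block; rewrite trmx_mxsub toQ_sym.
have det_M G : \det (M G) = (\det G)%:~R by rewrite det_mxsub_inj // det_map_mx.
set U := ursubmx (M E); set R := drsubmx (M E); set A := ulsubmx (M E).
have [ME Rsym] := M_block E Esym.
have Mpd : pd (M E) by apply: pd_mxsub.
have Rpd : pd R by exact: pd_drsub.
have pqA i j : A i j = (E (pq i) (pq j))%:~R by rewrite !mxE !fpq.
have Eoff a b : a != b -> E (pq a) (pq b) = 3.
  by rewrite /pq; case: a b => [[|[|?]] ?] [[|[|?]] ?] //= _.
(* Lowering the entry changes only the corner block, and a diagonal entry of the Schur complement is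
   positive. *)
have tilde_block i : posdef (tilde_at (pq i) E) ->
    0 < 3 - (U *m invmx R *m U^T) i i.
  move=> Tpd; have [MT _] := M_block _ (tr_tilde_at (pq i) Esym).
  have : pd (M (tilde_at (pq i) E)) by exact: pd_mxsub.
  have eU : ursubmx (M (tilde_at (pq i) E)) = U.
    by apply/matrixP => a b; rewrite !mxE (negPf (f_sep _ _)) andbF.
  have eR : drsubmx (M (tilde_at (pq i) E)) = R.
    by apply/matrixP => a b; rewrite !mxE (negPf (f_sep _ _)).
  rewrite MT eU eR pd_schurP // => /(pd_diag i).
  by rewrite mxE [X in X + _]mxE !mxE fpq eqxx.
(* On two indices [rev_ord] is the swap: [h] overwrites the other index by [pq i]. *)
have pullback_block i :
    let h x := if x == (pq (rev_ord i)) then pq i else x in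
    \det (pullback n h E) <= \det E ->
    \det (block_mx A (rowsub (fun=> i) U) (rowsub (fun=> i) U)^T R)
      <= \det (block_mx A U U^T R).
  move=> h; rewrite -(ler_int rat) -!det_M -ME.
  have Gsym : (pullback n h E)^T = pullback n h E.
    apply/matrixP => a b; rewrite !mxE eq_sym; case: ifP => // _.
    by rewrite eq_sym; case: ifP => // _; rewrite -{1}Esym mxE.
  have [-> _] := M_block _ Gsym.
  suff [-> -> ->] : [/\ ulsubmx (M (pullback n h E)) = A,
      ursubmx (M (pullback n h E)) = rowsub (fun=> i) U &
      drsubmx (M (pullback n h E)) = R] by [].
  have hpq a : h (pq a) = pq i.
    rewrite /h (inj_eq pq_inj); case: eqVneq => // aDi; congr pq; apply: val_inj.
    move: aDi; rewrite -val_eqE /=; have := ltn_ord a; have := ltn_ord i; lia.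
  have hR y : h (f (rshift 2 y)) = f (rshift 2 y) by rewrite /h (negPf (f_sep _ _)).
  split; apply/matrixP => a b; rewrite !mxE ?fpq ?hpq ?hR.
  (* The copies meet in 3, already the value of [E p q], so the corner block is unchanged. *)
  - rewrite eqxx (inj_eq pq_inj); case: eqVneq => [->|aDb]; first by rewrite Ediag.
    by rewrite Eoff.
  - by rewrite ![_ == f (rshift 2 b)]eq_sym !(negPf (f_sep _ _)).
  - by case: eqVneq => [->|//]; rewrite Ediag.
have : row 0 U = row 1 U.
  apply: (@eq_rows_of_det_le _ _ n%:~R A (U *m invmx R *m U^T) U R) => //.
  - by rewrite (ltr_int rat 3).
  - by move=> i; rewrite pqA Ediag.
  - by move=> i j iDj; rewrite pqA Eoff.
  - move=> i; apply: tilde_block; rewrite /pq; by case: ifP.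
  - move=> i; apply: pullback_block; rewrite /pq.
    case: i => [[|[|?]] ?] //=.
have /codomP[w zE] : z \in codom f.
  by apply: inj_card_onto; rewrite ?card_ord ?N_ge2.
move: zE; case: (split_ordP w) => y -> zE.
  by move: zDp zDq; rewrite zE fpq /pq; case: ifP; rewrite eqxx.
move=> /rowP/(_ y); rewrite !mxE !fpq -zE /pq /=.
exact: intr_inj.
Qed.

(** * The case of a leading block [Mr] *)

Theorem theorem9 (n : int) (r k : nat) (Mr : 'M[int]_r) (Estar : 'M[int]_(r + k))
    (i j : 'I_k) :
  (n == 3 %[mod 4])%Z -> 3 < n ->
  (0 < r)%N ->
  in_frakC n Mr ->
  0 < \det (tilde Mr) ->
  in_frakE n Mr Estar ->
  (forall E : 'M[int]_(r + k), in_frakE n Mr E -> \det E <= \det Estar) ->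
  i != j ->
  drsubmx Estar i j = 3 ->
  col i (ursubmx Estar) = col j (ursubmx Estar) /\
  (forall l : 'I_k, l != i -> l != j -> drsubmx Estar l i = drsubmx Estar l j).
Proof.
move=> n3 n_gt3 r_gt0 MrC Mr_tilde [EC EMr] Emax iDj; rewrite !mxE => Eij.
have [Esym Epd Ediag Emod] := EC.
rewrite ulsubmxEsub in EMr.
(* Reordering indices moves any copy of [Mr] to the leading position and keeps the determinant. *)
have Emax' (G : 'M_(r + k)) (g : 'I_r -> 'I_(r + k)) : injective g -> in_frakC n G ->
    mxsub g g G = Mr -> \det G <= \det Estar.
  move=> g_inj [Gsym Gpd Gdiag Gmod] GMr.
  have [f f_inj fg] := extend_injection g_inj (erefl (r + k)%N).
  rewrite -(det_mxsub_inj _ f_inj) //; apply: Emax; split; last first.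
    by rewrite -GMr; apply/matrixP => a b; rewrite !mxE !fg.
  split; [by rewrite trmx_mxsub Gsym | exact: posdef_mxsub | |].
  - by move=> a; rewrite mxE.
  - by move=> a b; rewrite mxE.
have tildeE l : posdef (tilde_at (rshift r l) Estar).
  apply: (maximal_tilde_posdef n3 n_gt3 r_gt0 Mr_tilde _ EC EMr _ Emax').
    exact: lshift_inj.
  by apply/codomP => -[x] /eqP; rewrite eq_rlshift.
(* Overwriting an index outside [Mr] by another one leaves the leading block intact, so the result
   competes with [Estar]. *)
have pull_le a b : a != b -> \det (pullback n
    (fun x => if x == rshift r b then rshift r a else x) Estar) <= \det Estar.
  move=> aDb; apply: (Emax' _ (lshift k)); first exact: lshift_inj.
  - have bDa : rshift r a != rshift r b by rewrite eq_rshift.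
    apply: (in_frakC_pullback n_gt3 bDa) => //=.
    + by rewrite eqxx (negPf bDa).
    + move=> x y; rewrite !inE => xDa yDa.
      case: eqVneq => [->|_]; case: eqVneq => [->|_] // e.
      * by rewrite -e eqxx in yDa.
      * by rewrite e eqxx in xDa.
    + by rewrite (negPf bDa); exact: tildeE.
  - rewrite -EMr; apply/matrixP => x y; rewrite !mxE !eq_lrshift.
    by case: eqVneq => // ->; rewrite Ediag.
have ijE := eq_entries_of_maximal n_gt3 EC _ Eij (tildeE i) (tildeE j)
  (pull_le _ _ iDj) _.
have Eeq z : z != rshift r i -> z != rshift r j ->
    Estar z (rshift r i) = Estar z (rshift r j).
  move=> zi zj; rewrite -Esym !mxE; apply: ijE => //; first by rewrite eq_rshift.
  by apply: pull_le; rewrite eq_sym.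
split; last by move=> l li lj; rewrite !mxE Eeq // eq_rshift.
by apply/colP => x; rewrite !mxE Eeq // eq_lrshift.
Qed.
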